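(* Let $\mathbf K$ be $\mathbf H$ or $\mathbf O$ and let $\hat{\mathbf K}=\mathbf K\cup\{\infty\}$ be its one-point compactification. Each fractional $\mathbf R$-linear pseudoconformal mapping $f:\hat{\mathbf K}\to\hat{\mathbf K}$ transforms each hypersphere in $\hat{\mathbf K}$ into a hypersphere in $\hat{\mathbf K}$.
   Context: $\tilde z$ is the conjugate of $z\in\mathbf K$ and $|z|^2=z\tilde z$. A hypersphere in $\hat{\mathbf K}$ is a set given by an equation $Ez\tilde z+J\tilde z+z\tilde J+D=0$ with $E,D\in\mathbf R$, $J\in\mathbf K$; these are usual hyperspheres $\{z:|z-z_0|=R\}$ and (for $E=0$) real hyperplanes, regarded as hyperspheres of infinite radius. A fractional $\mathbf R$-linear pseudoconformal mapping is a composition of mappings of the following types: (i) $z\mapsto z+c$ for a fixed $c\in\mathbf K$; (ii) $z\mapsto z^{-1}$; (iii) if $\mathbf K=\mathbf H$: $z\mapsto azb$ for fixed $a,b\in\mathbf H$ with $ab\ne0$; if $\mathbf K=\mathbf O$: $z\mapsto Yz$, where $Y$ is an ordered product of operators $Y_{k,m}$, $0\le k<m\le7$, given by $Y_{k,m}h=h+(-1+\cos t_{k,m})(h_ki_k+h_mi_m)+\sin(t_{k,m})(h_mi_k-h_ki_m)$ for $h=h_0i_0+\dots+h_7i_7\in\mathbf O$, $h_j\in\mathbf R$, with parameters $t_{k,m}\in\mathbf R$, where $i_0=1,i_1,\dots,i_7$ are the standard generators of $\mathbf O$. All are considered as maps $\hat{\mathbf K}\to\hat{\mathbf K}$. *)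

(* Defs.v *)
From HB Require Import structures.
From mathcomp Require Import all_boot all_order all_algebra.
From mathcomp Require Import all_classical all_reals all_analysis.
From mathcomp Require Import ring lra.
Set Implicit Arguments.
Unset Strict Implicit.
Unset Printing Implicit Defensive.
Import Order.TTheory GRing.Theory Num.Theory.
Import numFieldNormedType.Exports.

Local Open Scope classical_set_scope.
Local Open Scope ring_scope.

Reserved Notation "x *o y" (at level 40, left associativity, format "x  *o  y").

(* Cayley-Dickson algebras A_0 = R, A_1 = C, A_2 = H, A_3 = O.
   [cddim r] is 2 ^ r, but computes so that 'rV_(cddim r.+1) splits into blocks;
   an element of A_r is the row vector of its coordinates in the standard
   generators i_0 = 1, i_1, ..., i_(2^r - 1), i_k being the row 'e_k. *)
Fixpoint cddim (r : nat) : nat :=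
  if r is r'.+1 then (cddim r' + cddim r')%N else 1%N.

Lemma cddimE r : cddim r = (2 ^ r)%N.
Proof. by elim: r => //= r ->; rewrite expnS mul2n addnn. Qed.

Lemma cddim_gt0 r : (0 < cddim r)%N.
Proof. by rewrite cddimE expn_gt0. Qed.

Definition idx0 (r : nat) : 'I_(cddim r) := Ordinal (cddim_gt0 r).

Section CayleyDickson.
Variable R : realType.

Definition cd (r : nat) := 'rV[R]_(cddim r).

Fixpoint cdconj (r : nat) : cd r -> cd r :=
  match r with
  | 0 => fun z => z
  | r'.+1 => fun z =>
      row_mx (@cdconj r' (lsubmx z)) (- rsubmx z)
  end.

(* Doubling convention: (a + b l)(c + d l) = (a c - d~ b) + (d a + b c~) l,
   where the row (a, b) stands for a + b l, so that i_(2^r + k) = i_k l. *)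
Fixpoint cdmul (r : nat) : cd r -> cd r -> cd r :=
  match r with
  | 0 => fun z w => z *m w
  | r'.+1 => fun z w =>
      let a : cd r' := lsubmx z in let b : cd r' := rsubmx z in
      let c : cd r' := lsubmx w in let d : cd r' := rsubmx w in
      row_mx (@cdmul r' a c - @cdmul r' (cdconj d) b)
             (@cdmul r' d a + @cdmul r' b (cdconj c))
  end.

Definition cdgen (r : nat) (k : 'I_(cddim r)) : cd r := delta_mx 0 k.

Definition cdone (r : nat) : cd r := cdgen (idx0 r).

End CayleyDickson.

Notation "x *o y" := (cdmul x y) : ring_scope.

Notation quaternion R := (cd R 2).
Notation octonion R := (cd R 3).

Section Maps.
Variable R : realType.

(* z z~ is a real multiple of 1 (see [cdmul_conj]); this is its coordinate. *)
Definition sqnorm (r : nat) (z : cd R r) : R := (z *o cdconj z) 0 (idx0 r).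

Definition cdhat (r : nat) := one_point_compactification (cd R r).

Definition cdinfty (r : nat) : cdhat r := None.

Definition cdfin (r : nat) (z : cd R r) : cdhat r := Some z.

(* Extension of a self-map of A_r by infinity |-> infinity. *)
Definition fix_infty (r : nat) (g : cd R r -> cd R r) (x : cdhat r) : cdhat r :=
  if x is Some z then cdfin (g z) else cdinfty r.

Definition hat_inv (r : nat) (x : cdhat r) : cdhat r :=
  if x is Some z then
    if z == 0 then cdinfty r else cdfin ((sqnorm z)^-1 *: cdconj z)
  else cdfin 0.

(* The condition E D < |J|^2 says that the equation is not degenerate: its
   solutions form a sphere of positive radius if E != 0 and a genuine real
   hyperplane if E = 0 (see [hypersphereP]). The hyperplanes, and only they,
   pass through infinity. *)
Definition hypersphere (r : nat) (S : set (cdhat r)) : Prop :=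
  exists (E D : R) (J : cd R r), E * D < sqnorm J /\
    S = [set x | if x is Some z then
                   E *: (z *o cdconj z) + J *o cdconj z + z *o cdconj J
                     + D *: cdone R r = 0
                 else E = 0].

Definition quat_linear (g : quaternion R -> quaternion R) : Prop :=
  exists a b : quaternion R, a *o b != 0 /\ g = (fun z => a *o z *o b).

Definition oct_rot (k m : 'I_8) (t : R) (h : octonion R) : octonion R :=
  let i_ := @cdgen R 3 in
  h + (-1 + cos t) *: (h 0 k *: i_ k + h 0 m *: i_ m)
    + sin t *: (h 0 m *: i_ k - h 0 k *: i_ m).

(* Y is the product, in some order s, of the Y_{k,m} over all pairs k < m. *)
Definition oct_linear (g : octonion R -> octonion R) : Prop :=
  exists (s : seq ('I_8 * 'I_8)) (t : 'I_8 -> 'I_8 -> R),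
    perm_eq s [seq p : 'I_8 * 'I_8 <- enum {: 'I_8 * 'I_8} | (p.1 < p.2)%N] /\
    g = foldr (fun p Y => oct_rot p.1 p.2 (t p.1 p.2) \o Y) id s.

Inductive pseudoconformal (r : nat) (linear : (cd R r -> cd R r) -> Prop) :
    (cdhat r -> cdhat r) -> Prop :=
| pseudoconformal_shift (c : cd R r) :
    pseudoconformal linear (fix_infty (fun z => z + c))
| pseudoconformal_inv : pseudoconformal linear (@hat_inv r)
| pseudoconformal_linear g : linear g ->
    pseudoconformal linear (fix_infty g)
| pseudoconformal_comp f g : pseudoconformal linear f ->
    pseudoconformal linear g -> pseudoconformal linear (f \o g).

End Maps.

Section Checks.
Variable R : realType.
Implicit Type r : nat.

Lemma cdconjN r (z : cd R r) : cdconj (- z) = - cdconj z.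
Proof.
elim: r z => //= r IH z.
by rewrite !linearN /= IH opp_row_mx.
Qed.

Lemma cdconjK r : involutive (@cdconj R r).
Proof.
elim: r => //= r IH z.
by rewrite row_mxKl row_mxKr IH opprK hsubmxK.
Qed.

Lemma cdmulN r : (forall z w : cd R r, (- z) *o w = - (z *o w)) /\
  (forall z w : cd R r, z *o (- w) = - (z *o w)).
Proof.
elim: r => [|r [IHl IHr]] /=; split=> z w.
- exact: mulNmx.
- exact: mulmxN.
- by rewrite !linearN /= !(IHl, IHr) opp_row_mx !opprD.
- by rewrite !linearN /= !cdconjN !(IHl, IHr) opp_row_mx !opprD.
Qed.

Lemma cdconjZ r c (z : cd R r) : cdconj (c *: z) = c *: cdconj z.
Proof.
elim: r z => //= r IH z.
by rewrite !linearZ /= IH scale_row_mx scalerN.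
Qed.

Lemma cdmulZ r : (forall c (z w : cd R r), (c *: z) *o w = c *: (z *o w)) /\
  (forall c (z w : cd R r), z *o (c *: w) = c *: (z *o w)).
Proof.
elim: r => [|r [IHl IHr]] /=; split=> c z w.
- by rewrite -scalemxAl.
- by rewrite -scalemxAr.
- by rewrite !linearZ /= !(IHl, IHr) scale_row_mx scalerBr scalerDr.
- by rewrite !linearZ /= !cdconjZ !(IHl, IHr) scale_row_mx scalerBr scalerDr.
Qed.

Lemma cdoneS r : cdone R r.+1 = row_mx (cdone R r) 0.
Proof.
apply/rowP => k; rewrite !mxE /=.
case: splitP => j kj; rewrite !mxE -!val_eqE /= kj //.
by rewrite gtn_eqF ?andbF // ltn_addr ?cddim_gt0.
Qed.

Definition dot r (z w : cd R r) : R := \sum_k z 0 k * w 0 k.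

Lemma dotS r (z w : cd R r.+1) :
  dot z w = dot (lsubmx z : cd R r) (lsubmx w) + dot (rsubmx z : cd R r) (rsubmx w).
Proof.
by rewrite /dot /= big_split_ord; congr (_ + _); apply: eq_bigr => i _; rewrite !mxE.
Qed.

Lemma cdpolar r (z w : cd R r) :
  z *o cdconj w + w *o cdconj z = (2 * dot z w) *: cdone R r /\
  cdconj z *o w + cdconj w *o z = (2 * dot z w) *: cdone R r.
Proof.
elim: r z w => [|r IH] z w.
  suff E : z *o w + w *o z = (2 * dot z w) *: cdone R 0 by [].
  apply/rowP => k; rewrite !mxE /= /dot !big_ord1 !ord1 eqxx /=; ring.
have [mNl mNr] := cdmulN r.
rewrite cdoneS dotS mulrDr scale_row_mx scaler0 /=.
rewrite !row_mxKl !row_mxKr !cdconjK !(mNl, mNr, cdconjN, opprK) !add_row_mx.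
have [A A'] := IH (lsubmx z) (lsubmx w); have [_ B'] := IH (rsubmx z) (rsubmx w).
split; congr row_mx.
- by rewrite addrACA A addrC [X in X + _]addrC B' addrC scalerDl.
- by rewrite [X in _ + X]addrC addrACA addNr subrr addr0.
- by rewrite addrACA A' [X in _ + X]addrC B' scalerDl.
- by rewrite [X in _ + X]addrC addrACA subrr addNr addr0.
Qed.

Lemma cdmul_conj_dot r (z : cd R r) : z *o cdconj z = dot z z *: cdone R r.
Proof.
have [+ _] := cdpolar z z.
by rewrite -mulr2n -scaler_nat -scalerA => /(scalerI _) ->.
Qed.

Lemma sqnormE r (z : cd R r) : sqnorm z = \sum_k z 0 k ^+ 2.
Proof.
rewrite /sqnorm cdmul_conj_dot !mxE !eqxx mulr1.
by apply: eq_bigr => k _; rewrite expr2.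
Qed.

Lemma cdmul_conj r (z : cd R r) : z *o cdconj z = sqnorm z *: cdone R r.
Proof. by rewrite cdmul_conj_dot /sqnorm cdmul_conj_dot !mxE !eqxx mulr1. Qed.

Lemma cdeqnE r (E D : R) (J z : cd R r) :
  (E *: (z *o cdconj z) + J *o cdconj z + z *o cdconj J + D *: cdone R r = 0)
  <-> E * dot z z + 2 * dot J z + D = 0.
Proof.
have [P _] := cdpolar J z.
rewrite -[X in X + _]addrA P cdmul_conj_dot scalerA -!scalerDl.
split=> [/rowP/(_ (idx0 r))|->]; last by rewrite scale0r.
by rewrite !mxE !eqxx mulr1.
Qed.

Lemma dotDZ r (c : R) (J z : cd R r) :
  dot (z + c *: J) (z + c *: J) = dot z z + 2 * c * dot J z + c ^+ 2 * dot J J.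
Proof.
rewrite /dot !mulr_sumr -!big_split; apply: eq_bigr => k _ /=.
by rewrite !mxE; ring.
Qed.

Lemma sqnorm_dot r (z : cd R r) : sqnorm z = dot z z.
Proof. by rewrite sqnormE; apply: eq_bigr => k _; rewrite expr2. Qed.

Lemma sqnorm_ge0 r (z : cd R r) : 0 <= sqnorm z.
Proof. by rewrite sqnormE sumr_ge0// => k _; rewrite sqr_ge0. Qed.

Lemma sqnorm_gt0 r (z : cd R r) : (0 < sqnorm z) = (z != 0).
Proof.
rewrite lt_neqAle sqnorm_ge0 andbT eq_sym; congr negb.
apply/eqP/eqP => [|->]; last by rewrite sqnormE big1// => k _; rewrite mxE expr0n.
rewrite sqnormE => /eqP; rewrite psumr_eq0 => [/allP z0|k _]; last exact: sqr_ge0.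
apply/rowP => k; apply/eqP; rewrite mxE -sqrf_eq0.
by apply: z0; rewrite mem_index_enum.
Qed.

Lemma cdmulV r (z : cd R r) : z != 0 ->
  z *o ((sqnorm z)^-1 *: cdconj z) = cdone R r /\
  ((sqnorm z)^-1 *: cdconj z) *o z = cdone R r.
Proof.
rewrite -sqnorm_gt0 => z0; have [Zl Zr] := cdmulZ r.
have Nz : sqnorm (cdconj z) = sqnorm z.
  apply/eqP; rewrite -subr_eq0; apply/eqP.
  have [_] := cdpolar z z; have [+ _] := cdpolar (cdconj z) (cdconj z).
  rewrite !cdconjK => -> /rowP/(_ (idx0 r)).
  by rewrite !mxE !eqxx !mulr1 -!sqnorm_dot; lra.
split; first by rewrite Zr cdmul_conj scalerA mulVf ?scale1r// gt_eqF.
rewrite Zl; have := cdmul_conj (cdconj z); rewrite cdconjK Nz => ->.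
by rewrite scalerA mulVf ?scale1r// gt_eqF.
Qed.

Lemma hypersphereP r (S : set (cdhat R r)) : hypersphere S <->
  (exists z0 rho, 0 < rho /\
     S = @cdfin R r @` [set z | Num.sqrt (sqnorm (z - z0)) = rho]) \/
  (exists (J : cd R r) c, J != 0 /\
     S = cdinfty R r |` @cdfin R r @` [set z : cd R r | \sum_k J 0 k * z 0 k = c]).
Proof.
split=> [[E [D [J [ltJ ->]]]]|].
  have [E0|E0] := eqVneq E 0.
    right; exists J, (- D / 2); split.
      by rewrite -sqnorm_gt0; rewrite E0 mul0r in ltJ.
    apply/seteqP; split=> [[z|] /=|_ /= [->//|[z H <-]]].
    - move/cdeqnE; rewrite E0 mul0r add0r => H; right; exists z => //.
      by change (dot J z = - D / 2); lra.
    - by left.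
    - by apply/cdeqnE; rewrite E0 /dot H; lra.
  left; exists (- (E^-1 *: J)), (Num.sqrt ((sqnorm J - E * D) / E ^+ 2)).
  have rho0 : 0 < (sqnorm J - E * D) / E ^+ 2.
    by rewrite divr_gt0 ?subr_gt0// exprn_even_gt0.
  split; first by rewrite sqrtr_gt0.
  have eqE z : sqnorm (z - - (E^-1 *: J)) = (sqnorm J - E * D) / E ^+ 2 <->
      E * dot z z + 2 * dot J z + D = 0.
    rewrite opprK !sqnorm_dot dotDZ.
    split=> [H|H].
      have -> : E * dot z z + 2 * dot J z + D = E * ((dot z z + 2 * E^-1 * dot J z +
        E^-1 ^+ 2 * dot J J) - (dot J J - E * D) / E ^+ 2) by field.
      by rewrite H subrr mulr0.
    apply/eqP; rewrite -subr_eq0; apply/eqP.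
    transitivity (E^-1 * (E * dot z z + 2 * dot J z + D)); first by field.
    by rewrite H mulr0.
  apply/seteqP; split=> [[z|] /=|_ /= [z H <-]].
  - by move/cdeqnE/eqE => H; exists z => //=; rewrite H.
  - by move/eqP; rewrite (negbTE E0).
  - apply/cdeqnE/eqE; apply/eqP; rewrite -(eqr_sqrt (sqnorm_ge0 _) (ltW rho0)).
    exact/eqP.
case=> [[z0 [rho [rho0 ->]]]|[J [c [J0 ->]]]].
  exists 1, (sqnorm z0 - rho ^+ 2), (- z0); split.
    have -> : sqnorm (- z0) = sqnorm z0.
      by rewrite !sqnormE; apply: eq_bigr => k _; rewrite mxE sqrrN.
    by rewrite mul1r ltrBlDr ltrDl exprn_gt0.
  have eqE z : Num.sqrt (sqnorm (z - z0)) = rho <->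
      1 * dot z z + 2 * dot (- z0) z + (sqnorm z0 - rho ^+ 2) = 0.
    have -> : 1 * dot z z + 2 * dot (- z0) z + (sqnorm z0 - rho ^+ 2) =
        sqnorm (z - z0) - rho ^+ 2.
      have := dotDZ 1 (- z0) z; rewrite !sqnorm_dot scale1r => ->.
      have -> : dot (- z0) (- z0) = dot z0 z0 by apply: eq_bigr => k _; rewrite !mxE mulrNN.
      ring.
    split=> [<-|/eqP]; first by rewrite sqr_sqrtr ?sqnorm_ge0// subrr.
    by rewrite subr_eq0 => /eqP ->; rewrite sqrtr_sqr gtr0_norm.
  apply/seteqP; split=> [_ /= [z H <-]|[z|] /=].
  - exact/cdeqnE/eqE.
  - by move/cdeqnE/eqE => H; exists z.
  - by move/eqP; rewrite oner_eq0.
exists 0, (- 2 * c), J; split; first by rewrite mul0r sqnorm_gt0.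
apply/seteqP; split=> [_ /= [->//|[z H <-]]|[z|] /=].
- by apply/cdeqnE; rewrite /dot H; ring.
- move/cdeqnE => H; right; exists z => //.
  by change (dot J z = c); lra.
- by left.
Qed.

End Checks.

(* Main.v *)
Require Import Defs.
From mathcomp Require Import all_boot all_order all_algebra.
From mathcomp Require Import all_classical all_reals all_analysis.
From mathcomp Require Import ring lra.
Set Implicit Arguments.
Unset Strict Implicit.
Unset Printing Implicit Defensive.
Import Order.TTheory GRing.Theory Num.Theory.
Local Open Scope classical_set_scope.
Local Open Scope ring_scope.

(** Write [z . w] for the Euclidean inner product [dot z w]. By [cdeqnE] the
    equation of a hypersphere is the real equation [E |z|^2 + 2 J . z + D = 0],
    and it stays nondegenerate as long as [|J|^2 - E D > 0]. A mapping that is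
    onto and pulls one such equation back to another carries the second
    hypersphere onto the first, and this property is stable under composition,
    so only the three generators have to be examined:
    - a shift by [c] turns the triple [(E, J, D)] into
      [(E, J - E c, D - 2 J . c + E |c|^2)], with the same discriminant;
    - inversion [z |-> w = z~ / |z|^2] turns it into [(D, J~, E)]: divided by
      [|z|^2], the equation reads [E + 2 J~ . w + D |w|^2 = 0]; since [0] and
      infinity are exchanged, so are the tests [D = 0] and [E = 0] for passing
      through them;
    - a map [h] of A_r onto itself with [h z . h w = k (z . w)], [k > 0], turns
      it into [(E, h J, k D)], and multiplies the discriminant by [k].
    It remains to see that the linear generators are of the last kind. For
    [z |-> a z b] over the quaternions, associativity gives
    [(a z)(a w)~ + (a w)(a z)~ = a (z w~ + w z~) a~], in which the middle factor
    is the real number [2 (z . w)], so left multiplication by [a] scales inner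
    products by [|a|^2]; right multiplications follow by conjugating. The
    operators [Y_{k,m}] are plane rotations, hence isometries. *)

(** * Equations of hyperspheres *)

Section InnerProduct.
Variables (R : realType) (r : nat).
Implicit Types z w u : cd R r.

Lemma dotC z w : dot z w = dot w z.
Proof. by apply: eq_bigr => k _; rewrite mulrC. Qed.

Lemma dotDl z w u : dot (z + w) u = dot z u + dot w u.
Proof. by rewrite /dot -big_split; apply: eq_bigr => k _; rewrite mxE mulrDl. Qed.

Lemma dotZl (c : R) z u : dot (c *: z) u = c * dot z u.
Proof. by rewrite /dot mulr_sumr; apply: eq_bigr => k _; rewrite mxE mulrA. Qed.

Lemma dotDr z w u : dot u (z + w) = dot u z + dot u w.
Proof. by rewrite dotC dotDl !(dotC u). Qed.

Lemma dotZr (c : R) z u : dot u (c *: z) = c * dot u z.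
Proof. by rewrite dotC dotZl dotC. Qed.

Lemma dot0r u : dot u 0 = 0.
Proof. by rewrite -(scale0r 0) dotZr mul0r. Qed.

End InnerProduct.

Lemma dot_cdconj (R : realType) r (z w : cd R r) :
  dot (cdconj z) (cdconj w) = dot z w.
Proof.
elim: r z w => // r IH z w.
rewrite !dotS /= !row_mxKl !row_mxKr IH; congr (_ + _).
by rewrite /dot; apply: eq_bigr => k _; rewrite !mxE mulrNN.
Qed.

Section Hyperspheres.
Variables (R : realType) (r : nat).

Definition on_sphere (E D : R) (J : cd R r) (x : cdhat R r) : Prop :=
  if x is Some z then E * dot z z + 2 * dot J z + D = 0 else E = 0.

Lemma hypersphere_eqn (S : set (cdhat R r)) : hypersphere S <->
  exists E D J, E * D < dot J J /\ S = on_sphere E D J.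
Proof.
have eqS E D (J : cd R r) : [set x : cdhat R r | if x is Some z then
    E *: (z *o cdconj z) + J *o cdconj z + z *o cdconj J + D *: cdone R r = 0
    else E = 0] = on_sphere E D J.
  by apply/seteqP; split=> -[z|] //= /cdeqnE.
by split=> -[E [D [J [ltJ ->]]]]; exists E, D, J;
  move: ltJ; rewrite sqnorm_dot => ltJ; split; rewrite ?eqS.
Qed.

Definition preserves_hyperspheres (f : cdhat R r -> cdhat R r) : Prop :=
  forall S, hypersphere S -> hypersphere (f @` S).

(** The image of a hypersphere is found by guessing the new equation and
    checking it on the points [f x]; surjectivity excludes further solutions. *)
Lemma preserves_hyperspheresW (f : cdhat R r -> cdhat R r) :
  (forall y, exists x, f x = y) ->
  (forall E D J, E * D < dot J J -> exists E' D' J', E' * D' < dot J' J' /\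
     forall x, on_sphere E D J x <-> on_sphere E' D' J' (f x)) ->
  preserves_hyperspheres f.
Proof.
move=> f_onto f_eqn S /hypersphere_eqn[E [D [J [/f_eqn + ->]]]].
move=> [E' [D' [J' [lt' ff']]]]; apply/hypersphere_eqn; exists E', D', J'.
split=> //; apply/seteqP; split=> [_ [x /ff' + <-] //|y].
by have [x <-] := f_onto y => /ff'; exists x.
Qed.

Lemma preserves_hyperspheres_comp f g : preserves_hyperspheres f ->
  preserves_hyperspheres g -> preserves_hyperspheres (f \o g).
Proof. by move=> Pf Pg S /Pg/Pf; rewrite image_comp. Qed.

(** * The three kinds of generators *)

Lemma preserves_hyperspheres_shift (c : cd R r) :
  preserves_hyperspheres (fix_infty (fun z => z + c)).
Proof.
apply: preserves_hyperspheresW => [[y|]|E D J ltJ].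
- by exists (Some (y - c)); rewrite /= subrK.
- by exists None.
exists E, (D - 2 * dot J c + E * dot c c), (J + (- E) *: c); split.
  rewrite !(dotDl, dotDr, dotZl, dotZr) (dotC c J) -subr_gt0.
  by rewrite -subr_gt0 in ltJ; lra.
case=> [z|] //=; rewrite !(dotDl, dotDr, dotZl, dotZr) (dotC c z).
by split=> H; rewrite -[RHS]H; ring.
Qed.

Lemma hat_invK : involutive (@hat_inv R r).
Proof.
case=> [z|] /=; last by rewrite eqxx.
have [->//|z0] := eqVneq z 0.
have Nz : dot z z != 0 by rewrite -sqnorm_dot gt_eqF ?sqnorm_gt0.
have Niz : sqnorm ((sqnorm z)^-1 *: cdconj z) = (sqnorm z)^-1.
  rewrite !sqnorm_dot dotZl dotZr dot_cdconj; by field.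
rewrite /= ifF; last first.
  by apply/negbTE; rewrite -sqnorm_gt0 Niz invr_gt0 sqnorm_gt0.
congr Some; rewrite Niz cdconjZ cdconjK scalerA invrK mulfV ?scale1r //.
by rewrite sqnorm_dot.
Qed.

Lemma preserves_hyperspheres_inv : preserves_hyperspheres (@hat_inv R r).
Proof.
apply: preserves_hyperspheresW => [y|E D J ltJ].
  by exists (hat_inv y); rewrite hat_invK.
exists D, E, (cdconj J); rewrite dot_cdconj mulrC; split=> //.
case=> [z|] /=; last by rewrite !dot0r !mulr0 !add0r.
have [->/=|z0] := eqVneq z 0; first by rewrite !dot0r !mulr0 !add0r.
have Nz : dot z z != 0 by rewrite -sqnorm_dot gt_eqF ?sqnorm_gt0.
rewrite /= sqnorm_dot !(dotZl, dotZr) !dot_cdconj.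
split=> H; last first.
  apply: (mulfI (invr_neq0 Nz)); rewrite mulr0 -[RHS]H; by field.
apply: (mulfI Nz); rewrite mulr0 -[RHS]H; by field.
Qed.

Definition similarity (h : cd R r -> cd R r) : Prop :=
  (forall y, exists x, h x = y) /\
  exists k : R, 0 < k /\ forall z w, dot (h z) (h w) = k * dot z w.

Lemma similarity_comp g h : similarity g -> similarity h -> similarity (g \o h).
Proof.
move=> [og [k [k0 gk]]] [oh [l [l0 hl]]]; split=> [y|].
  by have [x <-] := og y; have [w <-] := oh x; exists w.
by exists (k * l); split=> [|z w /=]; rewrite ?mulr_gt0// gk hl mulrA.
Qed.

Lemma similarity_id : similarity id.
Proof. by split=> [y|]; [exists y | exists 1; split=> // z w; rewrite mul1r]. Qed.

Lemma preserves_hyperspheres_similarity h : similarity h ->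
  preserves_hyperspheres (fix_infty h).
Proof.
move=> [oh [k [k0 hk]]]; apply: preserves_hyperspheresW => [[y|]|E D J ltJ].
- by have [x <-] := oh y; exists (Some x).
- by exists None.
exists E, (k * D), (h J); split; first by rewrite hk mulrCA ltr_pM2l.
case=> [z|] //=; rewrite !hk.
have -> : E * (k * dot z z) + 2 * (k * dot J z) + k * D =
  k * (E * dot z z + 2 * dot J z + D) by ring.
by split=> [->|/eqP]; rewrite ?mulr0// mulf_eq0 gt_eqF//= => /eqP.
Qed.

Lemma pseudoconformal_preserves (linear : (cd R r -> cd R r) -> Prop) :
  (forall g, linear g -> similarity g) ->
  forall f, pseudoconformal linear f -> preserves_hyperspheres f.
Proof.
move=> lin_sim f; elim=> [c||g /lin_sim|{}f g _ + _].
- exact: preserves_hyperspheres_shift.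
- exact: preserves_hyperspheres_inv.
- exact: preserves_hyperspheres_similarity.
- exact: preserves_hyperspheres_comp.
Qed.

End Hyperspheres.

(** * Quaternionic multiplications are similarities *)

Section CayleyDicksonRing.
Variable R : realType.
Implicit Type r : nat.

Lemma cdconjD r (z w : cd R r) : cdconj (z + w) = cdconj z + cdconj w.
Proof.
elim: r z w => //= r IH z w.
by rewrite !linearD /= IH add_row_mx.
Qed.

Lemma cdconjB r (z w : cd R r) : cdconj (z - w) = cdconj z - cdconj w.
Proof. by rewrite cdconjD cdconjN. Qed.

Lemma cdmulD r : (forall z w u : cd R r, (z + w) *o u = z *o u + w *o u) /\
  (forall z w u : cd R r, z *o (w + u) = z *o w + z *o u).
Proof.
elim: r => [|r [IHl IHr]] /=; split=> z w u.
- exact: mulmxDl.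
- exact: mulmxDr.
- rewrite !linearD /= !(IHl, IHr) add_row_mx opprD.
  by congr row_mx; rewrite addrACA.
- rewrite !linearD /= !cdconjD !(IHl, IHr) add_row_mx opprD.
  by congr row_mx; rewrite addrACA.
Qed.

Lemma cdmulDl r (z w u : cd R r) : (z + w) *o u = z *o u + w *o u.
Proof. exact: (cdmulD r).1. Qed.

Lemma cdmulDr r (z w u : cd R r) : z *o (w + u) = z *o w + z *o u.
Proof. exact: (cdmulD r).2. Qed.

Lemma cdmulNl r (z w : cd R r) : (- z) *o w = - (z *o w).
Proof. exact: (cdmulN _ _).1. Qed.

Lemma cdmulNr r (z w : cd R r) : z *o (- w) = - (z *o w).
Proof. exact: (cdmulN _ _).2. Qed.

Lemma cdmul0l r (z : cd R r) : 0 *o z = 0.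
Proof. by rewrite -(scale0r 0) (cdmulZ _ _).1 !scale0r. Qed.

Lemma cdmul0r r (z : cd R r) : z *o 0 = 0.
Proof. by rewrite -(scale0r 0) (cdmulZ _ _).2 !scale0r. Qed.

Lemma cdconj1 r : cdconj (cdone R r) = cdone R r.
Proof.
by elim: r => // r IH; rewrite cdoneS /= row_mxKl row_mxKr IH oppr0.
Qed.

Lemma cdmul1 r : (forall z : cd R r, cdone R r *o z = z) /\
  (forall z : cd R r, z *o cdone R r = z).
Proof.
elim: r => [|r [IHl IHr]].
  by split=> z; apply/rowP => k; rewrite !mxE big_ord1 !mxE !ord1 !eqxx ?mul1r ?mulr1.
split=> z; rewrite cdoneS /= row_mxKl row_mxKr.
- by rewrite IHl IHr cdmul0r cdmul0l subr0 addr0 hsubmxK.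
- rewrite cdconj1 !IHr cdmul0l.
  have -> : cdconj (0 : cd R r) = 0 by rewrite -(scale0r 0) cdconjZ !scale0r.
  by rewrite cdmul0l subr0 add0r hsubmxK.
Qed.

Lemma cdconjM r (z w : cd R r) : cdconj (z *o w) = cdconj w *o cdconj z.
Proof.
elim: r z w => [|r IH] z w.
  by apply/rowP => k; rewrite !mxE !big_ord1 !ord1 mulrC.
rewrite /= !row_mxKl !row_mxKr cdconjB !IH !cdconjK cdconjN.
by rewrite !cdmulNl !cdmulNr !opprK opprD [X in row_mx _ X]addrC.
Qed.

Definition cd_comm r := forall z w : cd R r, z *o w = w *o z.
Definition cd_assoc r := forall z w u : cd R r, z *o (w *o u) = z *o w *o u.

Lemma cd_comm0 : cd_comm 0.
Proof. by move=> z w; apply/rowP => k; rewrite !mxE !big_ord1 !ord1 mulrC. Qed.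

Lemma cd_assoc0 : cd_assoc 0.
Proof. by move=> z w u; exact: mulmxA. Qed.

Lemma cd_commS r : (forall z : cd R r, cdconj z = z) -> cd_comm r -> cd_comm r.+1.
Proof.
move=> conjE C z w /=; rewrite !conjE !(C (lsubmx z)) !(C (rsubmx z)).
by rewrite [X in row_mx _ X]addrC.
Qed.

(** In a doubled algebra the two bracketings multiply the same three factors
    in different orders, so commutativity is needed before the doubling. *)
Lemma cd_assocS r : cd_comm r -> cd_assoc r -> cd_assoc r.+1.
Proof.
move=> C A z w u /=; rewrite !row_mxKl !row_mxKr.
rewrite !(cdconjD, cdconjN, cdconjM, cdconjK).
rewrite !(cdmulDl, cdmulDr, cdmulNl, cdmulNr).
set a := lsubmx z; set b := rsubmx z; set c := lsubmx w; set d := rsubmx w.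
set e := lsubmx u; set f := rsubmx u.
have rot x y t : x *o y *o t = y *o t *o x :> cd R r by rewrite -A C.
have swap x y t : x *o y *o t = x *o t *o y :> cd R r by rewrite -A (C y) A.
rewrite !A !opprD !addrA; congr row_mx.
- rewrite (rot a (cdconj f)) (rot (cdconj c)) (rot e).
  by rewrite [LHS](ACl (1*4*2*3))/=.
- rewrite (swap f c) (swap d _ a) (swap b (cdconj e)).
  rewrite (rot b (cdconj d)) (rot (cdconj d)) (swap f b).
  by rewrite [LHS](ACl (1*4*2*3))/=.
Qed.

Lemma quat_assoc : cd_assoc 2.
Proof.
have C1 : cd_comm 1 by apply: cd_commS => //; exact: cd_comm0.
apply: cd_assocS => //; apply: cd_assocS; [exact: cd_comm0 | exact: cd_assoc0].
Qed.

Lemma scale_cdone_inj r (c d : R) : c *: cdone R r = d *: cdone R r -> c = d.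
Proof. by move=> /rowP/(_ (idx0 r)); rewrite !mxE !eqxx !mulr1. Qed.

(** [2 (a z . a w)] is [a (z w~ + w z~) a~], with a real middle factor. *)
Lemma dot_cdmull r (a z w : cd R r) : cd_assoc r ->
  dot (a *o z) (a *o w) = dot a a * dot z w.
Proof.
move=> A; have two0 : (2 : R) != 0 by rewrite pnatr_eq0.
apply: (mulfI two0); apply: (@scale_cdone_inj r).
have conj_mid x y : (a *o x) *o cdconj (a *o y) = a *o (x *o cdconj y) *o cdconj a.
  by rewrite cdconjM !A.
have [<- _] := cdpolar (a *o z) (a *o w).
have [P _] := cdpolar z w.
rewrite !conj_mid -cdmulDl -cdmulDr P (cdmulZ _ _).2 (cdmul1 r).2 (cdmulZ _ _).1.
by rewrite cdmul_conj_dot scalerA; congr (_ *: _); ring.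
Qed.

(** Conjugation reverses products and preserves the inner product, so it
    exchanges left and right multiplications. *)
Lemma dot_cdmulr r (b z w : cd R r) : cd_assoc r ->
  dot (z *o b) (w *o b) = dot b b * dot z w.
Proof. by move=> A; rewrite -dot_cdconj !cdconjM dot_cdmull// !dot_cdconj. Qed.

Lemma cdmul_similarity r (a b : cd R r) : cd_assoc r -> a != 0 -> b != 0 ->
  similarity (fun z => a *o z *o b).
Proof.
move=> A a0 b0; split=> [y|]; last first.
  exists (dot b b * dot a a).
  split; first by rewrite mulr_gt0// -sqnorm_dot sqnorm_gt0.
  by move=> z w; rewrite dot_cdmulr// dot_cdmull// mulrA.
exists (((sqnorm a)^-1 *: cdconj a) *o (y *o ((sqnorm b)^-1 *: cdconj b))).
by rewrite A (cdmulV a0).1 (cdmul1 r).1 -A (cdmulV b0).2 (cdmul1 r).2.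
Qed.

Lemma quat_linear_similarity (g : quaternion R -> quaternion R) :
  quat_linear g -> similarity g.
Proof.
move=> [a [b [ab0 ->]]]; apply: (cdmul_similarity quat_assoc).
- by apply: contraNneq ab0 => ->; rewrite cdmul0l.
- by apply: contraNneq ab0 => ->; rewrite cdmul0r.
Qed.

End CayleyDicksonRing.

(** * Products of plane rotations are isometries *)

Section Rotations.
Variable R : realType.

Lemma oct_rotE (k m j : 'I_8) (t : R) (h : octonion R) : k != m ->
  oct_rot k m t h 0 j =
  if j == k then cos t * h 0 k + sin t * h 0 m
  else if j == m then cos t * h 0 m - sin t * h 0 k else h 0 j.
Proof.
move=> km; rewrite /oct_rot /cdgen !mxE eqxx /=.
have [->|jk] := eqVneq j k; first by rewrite (negbTE km) /=; ring.
by have [->|jm] := eqVneq j m; rewrite /=; ring.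
Qed.

Lemma oct_rotK (k m : 'I_8) (t : R) : k != m ->
  cancel (oct_rot k m (- t)) (oct_rot k m t).
Proof.
move=> km; have mk : m != k by rewrite eq_sym.
move=> h; apply/rowP => j; rewrite !oct_rotE// !eqxx (negbTE mk).
have cs := cos2Dsin2 t; rewrite cosN sinN.
have [->|jk] := eqVneq j k; first by rewrite -[RHS]mul1r -cs; ring.
by have [->|//] := eqVneq j m; rewrite -[RHS]mul1r -cs; ring.
Qed.

Lemma oct_rot_similarity (k m : 'I_8) (t : R) : k != m ->
  similarity (oct_rot k m t).
Proof.
move=> km; split=> [y|]; first by exists (oct_rot k m (- t) y); exact: oct_rotK.
exists 1; split=> // z w; rewrite mul1r /dot.
have mk : m != k by rewrite eq_sym.
rewrite (bigD1 k)//= (bigD1 m)//= [RHS](bigD1 k)//= [in RHS](bigD1 m)//= !addrA.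
congr (_ + _); last first.
  by apply: eq_bigr => j /andP[jk jm]; rewrite !oct_rotE// (negbTE jk) (negbTE jm).
rewrite !oct_rotE// !eqxx (negbTE mk).
rewrite -[RHS]mul1r -(cos2Dsin2 t); ring.
Qed.

Lemma oct_linear_similarity (g : octonion R -> octonion R) :
  oct_linear g -> similarity g.
Proof.
move=> [s [t [/perm_mem s_pairs ->]]].
have {s_pairs} : all (fun p => p.1 != p.2) s.
  apply/allP => p; rewrite s_pairs mem_filter => /andP[p12 _].
  by rewrite -val_eqE ltn_eqF.
elim: s => [_|p s IH /= /andP[p12 /IH sim]]; first exact: similarity_id.
exact: similarity_comp (oct_rot_similarity _ p12) sim.
Qed.

End Rotations.

Theorem theorem33 (R : realType) :
  (forall f : cdhat R 2 -> cdhat R 2, pseudoconformal (@quat_linear R) f ->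
     forall S : set (cdhat R 2), hypersphere S -> hypersphere (f @` S)) /\
  (forall f : cdhat R 3 -> cdhat R 3, pseudoconformal (@oct_linear R) f ->
     forall S : set (cdhat R 3), hypersphere S -> hypersphere (f @` S)).
Proof.
split; apply: pseudoconformal_preserves.
- exact: quat_linear_similarity.
- exact: oct_linear_similarity.
Qed.
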